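(* Let $M$ be a matroid of rank $4$ on ground set $T$ that is OTE. Let $M_1,M_2$ be extensions of $M$ with ground sets $E_1,E_2$ and rank functions $\operatorname{rk}_1,\operatorname{rk}_2$, such that $E_1\cap E_2=T$, $E=E_1\cup E_2$, and all of these matroids have finite rank and finite or countably infinite ground sets. Then the proper amalgam of $M_1$ and $M_2$ along $M$ exists, i.e. the function $\xi$ defined below is submodular on all subsets of $E$ (and hence is the rank function of a matroid on $E$).
   Context: Let $\operatorname{rk}$ be the rank function of $M$. For $X\subseteq E$ put $\eta(X)=\operatorname{rk}_1(X\cap E_1)+\operatorname{rk}_2(X\cap E_2)-\operatorname{rk}(X\cap T)$ and $\xi(X)=\min\{\eta(Y): Y\supseteq X,\ Y\subseteq E\}$. If $\xi$ is submodular it is the rank function of an amalgam of $M_1$ and $M_2$ (a matroid on $E$ whose restriction to $E_i$ is $M_i$), called the proper amalgam. A modular cut of $M$ is a set $\mathcal{M}$ of flats such that any flat containing a member is a member, and $F_1\cap F_2\in\mathcal{M}$ whenever $F_1,F_2\in\mathcal{M}$ satisfy $\operatorname{rk}(F_1)+\operatorname{rk}(F_2)=\operatorname{rk}(F_1\cup F_2)+\operatorname{rk}(F_1\cap F_2)$. It is principal if it equals $\{G\text{ flat}: G\supseteq F\}$ for a flat $F$. $M$ is OTE if every nonempty modular cut is principal. *)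

(* Defs.v *)
(* Built on MathComp and MathComp-Analysis' classical sets. *)
From mathcomp Require Import all_boot.
From mathcomp Require Import all_classical.

Set Implicit Arguments.
Unset Strict Implicit.
Unset Printing Implicit Defensive.

Local Open Scope classical_set_scope.
Local Open Scope card_scope.

(* Matroids of finite rank on a possibly infinite ground set. The ground set is
   a subset of a universe [U], so that several matroids with overlapping ground
   sets can be considered. Finite rank makes every independent set finite, so
   the usual augmentation axiom suffices and no finitary or maximality axiom is
   needed. *)
Record matroid (U : Type) := Matroid {
  ground : set U;
  indep : set (set U);
  indep_sub : forall I, indep I -> I `<=` ground;
  indep0 : indep set0;
  indepS : forall I J, indep J -> I `<=` J -> indep I;
  indep_aug : forall I J, indep I -> indep J -> ~~ (J #<= I) ->
    exists x, [/\ J x, ~ I x & indep (x |` I)];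
  indep_bounded : exists r : nat, forall I, indep I -> I #<= `I_r
}.

Section Matroid.
Context {U : Type}.
Implicit Types (M N : matroid U) (X Y F G I : set U).

Definition rank_spec M X (n : nat) : Prop :=
  (exists I, [/\ indep M I, I `<=` X & I #= `I_n]) /\
  (forall I, indep M I -> I `<=` X -> I #<= `I_n).

(* The default 0 is never used, see [rankP]. *)
Definition rank M X : nat := xget 0 (rank_spec M X).

Lemma rankP M X : rank_spec M X (rank M X).
Proof.
apply: xgetPex.
have [r hr] := indep_bounded M.
pose p n := `[< exists I, [/\ indep M I, I `<=` X & I #= `I_n] >].
have exp : exists n, p n.
  exists 0; apply/asboolP; exists set0; split => //; first exact: indep0.
  by rewrite II0.
have lep n : p n -> n <= r.
  move=> /asboolP[I [iI _ cI]]; rewrite -card_le_II.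
  by apply: card_le_trans (hr I iI); move: cI; rewrite card_eq_le => /andP[].
case: (ex_maxnP exp lep) => n /asboolP pn maxn; exists n; split => // I iI IX.
have [k cI] : finite_set I by apply: card_le_finite (hr I iI) _; exact: finite_II.
rewrite (card_le_eql cI) card_le_II; apply: maxn.
by apply/asboolP; exists I.
Qed.

Definition flat M F : Prop :=
  F `<=` ground M /\
  forall x, ground M x -> ~ F x -> rank M F < rank M (x |` F).

Definition modular_pair M F G : Prop :=
  rank M F + rank M G = rank M (F `|` G) + rank M (F `&` G).

Definition modular_cut M (C : set (set U)) : Prop :=
  [/\ C `<=` flat M,
      forall F G, C F -> flat M G -> F `<=` G -> C G
    & forall F G, C F -> C G -> modular_pair M F G -> C (F `&` G)].

Definition principal M (C : set (set U)) : Prop :=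
  exists2 F, flat M F & C = [set G | flat M G /\ F `<=` G].

Definition OTE M : Prop :=
  forall C, modular_cut M C -> C !=set0 -> principal M C.

(* The restriction of [N] to the ground set of [M] is [M]. *)
Definition extension N M : Prop :=
  ground M `<=` ground N /\
  forall I, I `<=` ground M -> (indep N I <-> indep M I).

Definition amalgam N M1 M2 : Prop :=
  [/\ ground N = ground M1 `|` ground M2, extension N M1 & extension N M2].

(* The subtraction of natural numbers is never truncated when [M1] extends [M],
   see [rank_le_eta]. *)
Definition eta M M1 M2 X : nat :=
  rank M1 (X `&` ground M1) + rank M2 (X `&` ground M2)
  - rank M (X `&` ground M).

Lemma rank_le_eta M M1 X : extension M1 M ->
  rank M (X `&` ground M) <= rank M1 (X `&` ground M1).
Proof.
move=> [sM eM]; have [[I [iI IX cI]] _] := rankP M (X `&` ground M).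
have [_ max1] := rankP M1 (X `&` ground M1).
rewrite -card_le_II; apply: (card_le_trans (B := I)).
  by move: cI; rewrite card_eq_le => /andP[].
apply: max1; first by apply/eM => //; exact: indep_sub iI.
by move=> x /IX[Xx /sM].
Qed.

Definition xi_spec M M1 M2 X (n : nat) : Prop :=
  let E := ground M1 `|` ground M2 in
  (exists Y, [/\ X `<=` Y, Y `<=` E & eta M M1 M2 Y = n]) /\
  (forall Y, X `<=` Y -> Y `<=` E -> n <= eta M M1 M2 Y).

(* The default 0 is only used when [X] is not a subset of the union of the
   ground sets, see [xiP]. *)
Definition xi M M1 M2 X : nat := xget 0 (xi_spec M M1 M2 X).

Lemma xiP M M1 M2 X : X `<=` ground M1 `|` ground M2 ->
  xi_spec M M1 M2 X (xi M M1 M2 X).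
Proof.
move=> XE; apply: xgetPex.
pose p n := `[< exists Y,
  [/\ X `<=` Y, Y `<=` ground M1 `|` ground M2 & eta M M1 M2 Y = n] >].
have exp : exists n, p n.
  by exists (eta M M1 M2 X); apply/asboolP; exists X; split.
case: (ex_minnP exp) => n /asboolP pn minn; exists n; split => // Y XY YE.
by apply: minn; apply/asboolP; exists Y.
Qed.

Definition submodular_on (E : set U) (f : set U -> nat) : Prop :=
  forall X Y, X `<=` E -> Y `<=` E -> f (X `|` Y) + f (X `&` Y) <= f X + f Y.

Definition proper_amalgam N M M1 M2 : Prop :=
  amalgam N M1 M2 /\
  forall X, X `<=` ground N -> rank N X = xi M M1 M2 X.

End Matroid.

(* Main.v *)
(* The rank functions satisfy eta = rk_1 + rk_2 - rk, so submodularity of eta on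
   a pair X, Y can only fail by the modular defect in M of the traces
   F = X n T and G = Y n T, which are flats of M when X and Y are inclusion-maximal
   minimisers of eta. In an OTE matroid of rank 4 any two planes are modular, so
   F and G are either disjoint coplanar lines or a plane and a disjoint line, with
   defect 1; failure then forces X and Y to be modular in both M_1 and M_2. Put
   D = X n Y. The flats of M having maximal connectivity to D in M_i form a modular
   cut, which by OTE cannot contain two disjoint flats unless that connectivity
   is 0. This leaves two possibilities: for two lines, X u Y spans T in both M_1
   and M_2 and adding T to X u Y lowers eta; for a plane F, it has connectivity 2
   to D on both sides and adding F to X n Y lowers eta. Either way the missing 1
   is recovered, which is what submodularity of xi needs. *)
Require Import Defs.
From mathcomp Require Import all_boot.
From mathcomp Require Import all_classical.
From mathcomp Require Import finmap zify.

Set Implicit Arguments.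
Unset Strict Implicit.
Unset Printing Implicit Defensive.

Local Open Scope classical_set_scope.
Local Open Scope card_scope.

Ltac sets := let x := fresh "x" in move=> x;
  repeat match goal with H : _ `<=` _ |- _ => move: (H x); clear H end;
  rewrite /setU /setI /set1 /mkset /=; tauto.

(** * Cardinalities of finite sets *)

Section Cardinality.
Context {T : Type}.
Implicit Types A B : set T.

Lemma card_eq_uniq A n m : A #= `I_n -> A #= `I_m -> n = m.
Proof. by move=> An Am; apply/card_eq_II; rewrite -(card_eql An). Qed.

Lemma card_le_nat A B n m : A #= `I_n -> B #= `I_m -> (A #<= B) = (n <= m).
Proof. by move=> An Bm; rewrite (card_le_eql An) (card_le_eqr Bm) card_le_II. Qed.

Lemma card_eqUI A B a b u i : A #= `I_a -> B #= `I_b ->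
  A `|` B #= `I_u -> A `&` B #= `I_i -> u + i = a + b.
Proof.
move=> Aa Bb Uu Ii.
have fA : finite_set A by apply/finite_setP; exists a.
have fB : finite_set B by apply/finite_setP; exists b.
(* The copy [{classic T}] supplies the choice structure that finite sets over [T] require. *)
have card n C : C #= `I_n -> #|` fset_set (C : set {classic T})| = n.
  exact: card_fset_set.
rewrite -(card _ _ Aa) -(card _ _ Bb) -(card _ _ Uu) -(card _ _ Ii).
by rewrite (@fset_setU {classic T}) // (@fset_setI {classic T}) // cardfsUI.
Qed.

Lemma card_eqU1 A x n : A #= `I_n -> ~ A x -> (x |` A) #= `I_n.+1.
Proof.
move=> An Ax.
have /finite_setP[m xAm] : finite_set (x |` A).
  by rewrite finite_setU; split; [exact: finite_set1 | apply/finite_setP; exists n].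
have xA0 : [set x] `&` A #= `I_0.
  by rewrite II0 card_eq0; apply/eqP/seteqP; split=> y //= -[-> ].
have := card_eqUI (@card_set1 _ x) An xAm xA0.
by rewrite addn0 add1n => <-.
Qed.

End Cardinality.

(** * Bases, submodularity and spans for the rank function *)

Section Rank.
Context {U : Type} (M : matroid U).
Implicit Types (X Y A B I J : set U).

Lemma rank_mono X Y : X `<=` Y -> rank M X <= rank M Y.
Proof.
move=> XY; have [[I [iI IX cI]] _] := rankP M X; have [_ maxY] := rankP M Y.
rewrite -card_le_II -(card_le_eql cI); apply: maxY => //.
exact: subset_trans XY.
Qed.

Lemma rank_ge X I n : indep M I -> I `<=` X -> I #= `I_n -> n <= rank M X.
Proof.
move=> iI IX cI; have [_ maxX] := rankP M X.
by rewrite -card_le_II -(card_le_eql cI); exact: maxX.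
Qed.

Lemma indep_finite I : indep M I -> finite_set I.
Proof.
by move=> iI; apply/finite_set_leP; have [r hr] := indep_bounded M; exists r; exact: hr.
Qed.

Lemma rank_indep I : indep M I -> I #= `I_(rank M I).
Proof.
move=> iI; have /finite_setP[n cI] := indep_finite iI.
suff -> : rank M I = n by [].
apply/eqP; rewrite eqn_leq (@rank_ge I I n) // andbT.
have [[J [iJ JI cJ]] _] := rankP M I.
by rewrite -(card_le_nat cJ cI); exact: subset_card_le.
Qed.

Lemma rank_indepU1 X I : indep M I -> I `<=` X -> rank M I < rank M X ->
  exists x, [/\ X x, ~ I x & indep M (x |` I)].
Proof.
move=> iI IX ltr; have [[J [iJ JX cJ]] _] := rankP M X.
have [|x [Jx nIx ix]] := @indep_aug _ M I J iI iJ.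
  by rewrite (card_le_nat cJ (rank_indep iI)) -ltnNge.
by exists x; split => //; exact: JX.
Qed.

Lemma extend_basis X I : indep M I -> I `<=` X ->
  exists J, [/\ indep M J, I `<=` J, J `<=` X & rank M J = rank M X].
Proof.
move=> iI IX; have [k] := ubnP (rank M X - rank M I).
elim: k I iI IX => // k IHk I iI IX ltk.
have := rank_mono IX; rewrite leq_eqVlt => /orP[/eqP eqr|ltr].
  by exists I; split.
have [x [Xx nIx ix]] := rank_indepU1 iI IX ltr.
have xIX : x |` I `<=` X by move=> y [->|/IX].
have rx : rank M (x |` I) = (rank M I).+1.
  exact: card_eq_uniq (rank_indep ix) (card_eqU1 (rank_indep iI) nIx).
have [|J [iJ IJ JX rJ]] := IHk _ ix xIX; first by rewrite rx; lia.
by exists J; split => // y Iy; apply: IJ; right.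
Qed.

Lemma rank_basis X : exists I, [/\ indep M I, I `<=` X & rank M I = rank M X].
Proof.
have [I [? _ ? ?]] := extend_basis (indep0 M) (@sub0set _ X).
by exists I.
Qed.

Lemma rank0 : rank M set0 = 0.
Proof.
apply/esym/(@card_eq_uniq _ set0); first by rewrite II0 card_eq00.
exact/rank_indep/indep0.
Qed.

(** A basis of the intersection extends to a basis [J] of the union, and counting [J] inside [A] and
    [B] gives the inequality. Monotonicity is built in through [X] and [Y], so each use leaves only
    two inclusions to check. *)
Lemma rank_submod A B X Y : X `<=` A `|` B -> Y `<=` A `&` B ->
  rank M X + rank M Y <= rank M A + rank M B.
Proof.
move=> /rank_mono leX /rank_mono leY; apply: leq_trans (leq_add leX leY) _.
have [I [iI IAB rI]] := rank_basis (A `&` B).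
have [|J [iJ IJ JAB rJ]] := @extend_basis (A `|` B) I iI.
  by move=> x /IAB[]; left.
have sub C : indep M (J `&` C) by apply: indepS iJ _ => x [].
have eJ : J = (J `&` A) `|` (J `&` B).
  by rewrite -setIUr; apply/seteqP; split=> x; [move=> Jx; split=> //; exact: JAB|case].
have eI : J `&` (A `&` B) = (J `&` A) `&` (J `&` B) by rewrite setIACA setIid.
have rJI : rank M (A `&` B) <= rank M (J `&` (A `&` B)).
  by rewrite -rI; apply: rank_mono => x Ix; split; [exact: IJ|exact: IAB].
have := card_eqUI (rank_indep (sub A)) (rank_indep (sub B)).
rewrite -eJ -eI => /(_ _ _ (rank_indep iJ) (rank_indep (sub _))).
rewrite rJ => cJ.
have /rank_mono := @subIsetr _ J A; have /rank_mono := @subIsetr _ J B.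
by lia.
Qed.

Lemma rank1 x : rank M [set x] <= 1.
Proof.
have [[I [_ Ix cI]] _] := rankP M [set x].
by rewrite -(card_le_nat cI (@card_set1 _ x)); exact: subset_card_le.
Qed.

Lemma rankU1 x X : rank M (x |` X) <= (rank M X).+1.
Proof.
have := rank_submod (@subset_refl _ (x |` X)) (@sub0set _ ([set x] `&` X)).
by have := rank1 x; rewrite rank0; lia.
Qed.

(* The rank of an infinite set is attained on a finite subset, hence this does
   not follow from submodularity alone. *)
Lemma rank_spanned X A : (forall x, A x -> rank M (x |` X) <= rank M X) ->
  rank M (X `|` A) <= rank M X.
Proof.
move=> spA; rewrite leqNgt; apply/negP => ltr.
have [I [iI IX rI]] := rank_basis X.
have [||x [XAx nIx ix]] := @rank_indepU1 (X `|` A) I iI.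
- by move=> y /IX; left.
- by rewrite rI.
have xX : rank M (x |` I) <= rank M X.
  case: XAx => [Xx|Ax]; first by apply: rank_mono => y [->//|/IX].
  by apply: leq_trans (spA x Ax); apply: rank_mono => y [->|/IX]; [left|right].
have := card_eq_uniq (rank_indep ix) (card_eqU1 (rank_indep iI) nIx).
by lia.
Qed.

Lemma rankIground X : rank M (X `&` ground M) = rank M X.
Proof.
apply/eqP; rewrite eqn_leq rank_mono /=; last by move=> x [].
have [I [iI IX <-]] := rank_basis X.
by apply: rank_mono => x Ix; split; [exact: IX|exact: indep_sub iI _ Ix].
Qed.

(** Lets matroids be compared through their ranks. A basis of [I] missing a point of [I] would, with
    that point added, be a subset of [I] with more elements than [I]. *)
Lemma indepE I : indep M I <-> I `<=` ground M /\ I #= `I_(rank M I).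
Proof.
split=> [iI|[IT cI]]; first by split; [exact: indep_sub iI|exact: rank_indep].
have [J [iJ JI rJ]] := rank_basis I.
suff -> : I = J by [].
apply/seteqP; split=> // x Ix; apply: contrapT => nJx.
have := card_eqU1 (rank_indep iJ) nJx; rewrite rJ => cxJ.
have := card_le_nat cxJ cI; rewrite ltnn => /negP; apply.
by apply: subset_card_le => y [->|/JI].
Qed.

End Rank.

(** * Flats, extensions, and modular cuts in an OTE matroid *)

Section Flats.
Context {U : Type} (M : matroid U).
Implicit Types (F G H K D X : set U).

Lemma flat_spanned F G : flat M F -> F `<=` G -> G `<=` ground M ->
  rank M G <= rank M F -> G `<=` F.
Proof.
move=> [_ flF] FG GT rG x Gx; apply: contrapT => nFx.
have := flF x (GT x Gx) nFx; rewrite ltnNge => /negP; apply.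
by apply: leq_trans rG; apply: rank_mono => y [->|/FG].
Qed.

Lemma flatI F G : flat M F -> flat M G -> flat M (F `&` G).
Proof.
move=> [FT flF] [GT flG]; split=> [|x Tx nx]; first by sets.
have [Fx|nFx] := pselect (F x); last first.
  have := flF x Tx nFx.
  have : rank M (x |` F) + rank M (F `&` G) <= rank M (x |` F `&` G) + rank M F.
    by apply: rank_submod; sets.
  by lia.
have nGx : ~ G x by move=> Gx; apply: nx.
have := flG x Tx nGx.
have : rank M (x |` G) + rank M (F `&` G) <= rank M (x |` F `&` G) + rank M G.
  by apply: rank_submod; sets.
by lia.
Qed.

Lemma flat_ground : flat M (ground M).
Proof. by split. Qed.

Lemma extension_rank N X : extension N M -> rank N (X `&` ground M) = rank M X.
Proof.
move=> [_ eNM]; rewrite -(rankIground M X).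
apply/eqP; rewrite eqn_leq; apply/andP; split.
  have [I [iI IX <-]] := rank_basis N (X `&` ground M).
  have iMI : indep M I by apply/eNM => // x /IX[].
  rewrite (card_eq_uniq (rank_indep iI) (rank_indep iMI)).
  exact: rank_mono.
have [I [iI IX <-]] := rank_basis M (X `&` ground M).
have iNI : indep N I by apply/eNM => //; exact: indep_sub iI.
rewrite (card_eq_uniq (rank_indep iI) (rank_indep iNI)).
exact: rank_mono.
Qed.

Lemma extension_rank_sub N X : extension N M -> X `<=` ground M ->
  rank N X = rank M X.
Proof. by move=> eNM XT; rewrite -(extension_rank X eNM) setIidl. Qed.

(** Since comparable flats are modular, two nonmodular hyperplanes together with the ground set
    would form a modular cut without a least member. *)
Lemma OTE_hyperplanes F G : OTE M -> flat M F -> flat M G ->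
  rank M (ground M) = (rank M F).+1 -> rank M (ground M) = (rank M G).+1 ->
  modular_pair M F G.
Proof.
move=> oteM flF flG rF rG; apply: contrapT => nmod.
have [[FT _] [GT _]] := (flF, flG).
pose C : set (set U) := [set H | [\/ H = F, H = G | H = ground M]].
have up H K : rank M (ground M) = (rank M H).+1 -> flat M H -> flat M K ->
    H `<=` K -> K = H \/ K = ground M.
  move=> rH flH flK HK; have [KT _] := flK.
  have [|ltr] := leqP (rank M K) (rank M H).
    by left; apply/seteqP; split=> //; exact: flat_spanned.
  right; apply/seteqP; split => //; apply: flat_spanned => //.
  by rewrite rH.
have cutC : modular_cut M C.
  split.
  - by move=> H [->|->|->] //; exact: flat_ground.
  - move=> H K [->|->|->] flK HK; rewrite /C /=.
    + by have [->|->] := up F K rF flF flK HK; [exact: Or31|exact: Or33].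
    + by have [->|->] := up G K rG flG flK HK; [exact: Or32|exact: Or33].
    + by apply: Or33; apply/seteqP; split => //; case: flK.
  - move=> H K CH CK; move: CH CK => [->|->|->] [->|->|->] modHK //; rewrite /C /=.
    all: rewrite ?setIid ?(setIidl FT) ?(setIidl GT) ?(setIidr FT) ?(setIidr GT).
    all: try by [constructor 1|constructor 2|constructor 3].
    by case: nmod; rewrite /modular_pair setUC setIC addnC.
have [|K flK eC] := oteM C cutC; first by exists F; exact: Or31.
have /[!eC]-[_ KF] : C F by exact: Or31.
have /[!eC]-[_ KG] : C G by exact: Or32.
have : C K by rewrite eC; split.
have FG : F `<=` G -> modular_pair M F G.
  by move=> FG; rewrite /modular_pair (setUidr FG) (setIidl FG) addnC.
case=> eK; apply: nmod; move: KF KG; rewrite eK //.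
- move=> GF _; rewrite /modular_pair setUC setIC addnC.
  by rewrite (setUidr GF) (setIidl GF) addnC.
- by move=> TF _; have := rank_mono M TF; rewrite rF ltnn.
Qed.

(* The displayed inequality for a flat H says that the connectivity
   r(H) + r_N(D) - r_N(H u D) of H and D takes its maximal value, which is
   attained at the ground set. The flats with this property form a modular
   cut. *)
Lemma OTE_max_connectivityI N D F G : OTE M -> extension N M ->
  flat M F -> flat M G ->
  rank M (ground M) + rank N (F `|` D) <= rank M F + rank N (ground M `|` D) ->
  rank M (ground M) + rank N (G `|` D) <= rank M G + rank N (ground M `|` D) ->
  rank M (ground M) + rank N (F `&` G `|` D) <=
    rank M (F `&` G) + rank N (ground M `|` D).
Proof.
move=> oteM eNM flF flG maxF maxG.
pose C := [set H | flat M H /\ rank M (ground M) + rank N (H `|` D) <=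
  rank M H + rank N (ground M `|` D)].
have rNM H : H `<=` ground M -> rank N H = rank M H.
  by move=> HT; exact: extension_rank_sub.
have diff H K : H `<=` K -> K `<=` ground M ->
    rank N (K `|` D) + rank M H <= rank M K + rank N (H `|` D).
  move=> HK KT; rewrite -!rNM //; last by sets.
  by apply: rank_submod; sets.
have up H K : C H -> flat M K -> H `<=` K -> C K.
  move=> [flH maxH] flK HK; split => //.
  by have := diff H K HK (proj1 flK); lia.
have cutC : modular_cut M C.
  split=> [H []//| |]; first exact: up.
  move=> H K [flH maxH] [flK maxK] modHK; split; first exact: flatI.
  have [[HT _] [KT _]] := (flH, flK).
  have HKT : H `|` K `<=` ground M by sets.
  have : rank N (H `|` K `|` D) + rank N (H `&` K `|` D) <=
      rank N (H `|` D) + rank N (K `|` D) by apply: rank_submod; sets.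
  have := diff _ _ HKT (@subset_refl _ _).
  by move: modHK; rewrite /modular_pair; lia.
have [|K flK eC] := oteM C cutC; first by exists F.
have /[!eC]-[_ KF] : C F by [].
have /[!eC]-[_ KG] : C G by [].
have CK : C K by rewrite eC; split.
have [|//] := up K (F `&` G) CK (flatI flF flG).
by sets.
Qed.

End Flats.

(** * One extension [N] of [M]: spanned points of [T] and connectivity *)

Section Sides.
Context {U : Type} (M N : matroid U) (eNM : extension N M).
Implicit Types (F G X Y A B D : set U).
Let T := ground M.

Lemma extension_rank_le X : rank M X <= rank N X.
Proof. by rewrite -(extension_rank X eNM); apply: rank_mono; sets. Qed.

(** Submodularity in [N] of [X] and the trace of [A u X] on [T]: adding points of [T] raises the
    rank in [N] by no more than the rank in [M]. *)
Lemma extension_rankU A X : A `<=` T ->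
  rank N (A `|` X) + rank M X <= rank N X + rank M (A `|` X).
Proof.
rewrite /T -!(fun Z => extension_rank Z eNM) => AT.
by apply: rank_submod; sets.
Qed.

(** Closedness in [N] tested only at points of [T]. The set [X] may have elements outside the ground
    set of [N], which ranks ignore. *)
Definition spans_no_new X : Prop :=
  forall x, T x -> rank N (x |` X) <= rank N X -> X x.

Lemma spans_no_newI X Y :
  spans_no_new X -> spans_no_new Y -> spans_no_new (X `&` Y).
Proof.
move=> clX clY x Tx sx.
have : rank N (x |` X) + rank N (X `&` Y) <= rank N (x |` X `&` Y) + rank N X.
  by apply: rank_submod; sets.
have : rank N (x |` Y) + rank N (X `&` Y) <= rank N (x |` X `&` Y) + rank N Y.
  by apply: rank_submod; sets.
by split; [apply: clX => //; lia|apply: clY => //; lia].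
Qed.

Lemma spans_no_new_flat X : spans_no_new X -> flat M (X `&` T).
Proof.
move=> clX; split=> [|x Tx nXTx]; first by sets.
rewrite ltnNge; apply/negP => sx; apply: nXTx; split=> //; apply: clX => //.
have xXT : x |` (X `&` T) `<=` T by move=> y [->|[]].
have XT : X `&` T `<=` T by sets.
have : rank N (x |` X) + rank N (X `&` T) <= rank N (x |` (X `&` T)) + rank N X.
  by apply: rank_submod; sets.
rewrite (extension_rank_sub eNM xXT) (extension_rank_sub eNM XT).
by lia.
Qed.

Lemma spans_no_new_lt A D : spans_no_new D -> A `<=` T -> ~ (A `<=` D) ->
  rank N D < rank N (A `|` D).
Proof.
move=> clD AT nAD; rewrite ltnNge; apply/negP => sAD; apply: nAD => x Ax.
apply: clD; first exact: AT.
by apply: leq_trans sAD; apply: rank_mono => y [->|]; [left|right].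
Qed.

(** After contracting the intersection of [X] and [Y], modularity says that [X] and [Y] are skew,
    and skewness passes to subsets. *)
Lemma modular_pair_contract X Y A B : A `<=` X -> B `<=` Y ->
  rank N X + rank N Y <= rank N (X `|` Y) + rank N (X `&` Y) ->
  rank N (A `|` X `&` Y) + rank N (B `|` X `&` Y) <=
    rank N (A `|` B `|` X `&` Y) + rank N (X `&` Y).
Proof.
move=> AX BY.
have : rank N (X `|` B) + rank N (A `|` X `&` Y) <=
    rank N X + rank N (A `|` B `|` X `&` Y) by apply: rank_submod; sets.
have : rank N (X `|` Y) + rank N (B `|` X `&` Y) <=
    rank N Y + rank N (X `|` B) by apply: rank_submod; sets.
by lia.
Qed.

(** Write c(H) = r(H) + r_N(D) - r_N(H u D), which is monotone on subsets of [T]. The strict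
    inequalities give c(G) <= 1, and [skew] gives c(F u G) <= c(F) + c(G) - 1 in both cases; hence
    c(G) = 1 and c(F u G) = c(F) >= 1. For two lines c(F) = 1, so c(T) >= 2 and r_N(T u D) <= r_N(D)
    + 2 = r_N(F u G u D). For a plane [F], c(T) = c(F u G) = c(F), which must exceed c(G). *)
Lemma nonmodular_skew F G D : OTE M -> flat M F -> flat M G ->
  rank M T = 4 -> rank M G = 2 -> rank M (F `&` G) = 0 ->
  rank N D < rank N (F `|` D) -> rank N D < rank N (G `|` D) ->
  rank N (F `|` D) + rank N (G `|` D) <= rank N (F `|` G `|` D) + rank N D ->
  (rank M F = 2 -> rank M (F `|` G) = 3 ->
     rank N (T `|` D) <= rank N (F `|` G `|` D)) /\
  (rank M F = 3 -> rank M (F `|` G) = 4 ->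
     rank N (F `|` D) <= (rank N D).+1).
Proof.
move=> oteM flF flG rT rG rFG ltF ltG skew.
have [[FT _] [GT _]] := (flF, flG).
have diff H K : H `<=` K -> K `<=` T ->
    rank N (K `|` D) + rank M H <= rank M K + rank N (H `|` D).
  move=> HK KT; have HT : H `<=` T by sets.
  rewrite -(extension_rank_sub eNM HT) -(extension_rank_sub eNM KT).
  by apply: rank_submod; sets.
have FGT : F `|` G `<=` T by sets.
have := diff F (F `|` G) (@subsetUl _ _ _) FGT.
have := diff G (F `|` G) (@subsetUr _ _ _) FGT.
have := diff (F `|` G) T FGT (@subset_refl _ _).
have : rank N (F `|` G `|` D) <= rank N (T `|` D) by apply: rank_mono; sets.
have : rank N D <= rank N (F `&` G `|` D) by apply: rank_mono; sets.
(* The intersection of [F] and [G] has rank 0, hence connectivity 0 to [D]; so [F] and [G] cannot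
   both reach the positive value at [T]. *)
have := OTE_max_connectivityI (D := D) oteM eNM flF flG.
rewrite -/T rT rG rFG => cut leD leT dT dG dF.
by split=> rF rU; rewrite rF rU in cut dT dG dF *; lia.
Qed.

End Sides.

(** * The functions [eta] and [xi] of two extensions *)

Section Amalgam.
Context {U : Type} (M M1 M2 : matroid U).
Context (extM1 : extension M1 M) (extM2 : extension M2 M).
Context (capT : ground M1 `&` ground M2 = ground M).
Implicit Types (X Y Z A : set U).
Let T := ground M.
Let E := ground M1 `|` ground M2.
Let eta := eta M M1 M2.
Let xi := xi M M1 M2.

Let TE : T `<=` E. Proof. by move=> x /(proj1 extM1); left. Qed.

(** Additive form of [eta], free of truncated subtraction; the intersections with ground sets
    disappear because ranks ignore outside points. *)
Lemma eta_rank X : eta X + rank M X = rank M1 X + rank M2 X.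
Proof.
rewrite /eta /Defs.eta !rankIground subnK //.
exact: leq_trans (extension_rank_le extM1 X) (leq_addr _ _).
Qed.

Lemma xi_le_eta X Y : X `<=` Y -> Y `<=` E -> xi X <= eta Y.
Proof.
move=> XY YE; have [_ min] := @xiP _ M M1 M2 X (subset_trans XY YE).
exact: min.
Qed.

Lemma xi_attained X : X `<=` E -> exists Y, [/\ X `<=` Y, Y `<=` E & eta Y = xi X].
Proof. by move=> /(xiP M)[]. Qed.

Lemma xi_mono X Y : X `<=` Y -> Y `<=` E -> xi X <= xi Y.
Proof.
move=> XY YE; have [Z [YZ ZE <-]] := xi_attained YE.
by apply: xi_le_eta => //; exact: subset_trans YZ.
Qed.

(** For a point of [T], the growth of the rank in [M1] is absorbed by that in [M]; any other point
    lies in only one of the two ground sets. *)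
Lemma eta_rankU1 x X : E x -> eta (x |` X) <= (eta X).+1.
Proof.
move=> Ex; have := eta_rank X; have := eta_rank (x |` X).
have rM : rank M X <= rank M (x |` X) by apply: rank_mono; sets.
have out N : ~ ground N x -> rank N (x |` X) <= rank N X.
  by move=> nNx; rewrite -rankIground; apply: rank_mono => y [[->|]].
have inT : T x -> rank M1 (x |` X) + rank M X <= rank M1 X + rank M (x |` X).
  by move=> Tx; apply: extension_rankU => // _ ->.
have r1 := rankU1 M1 x X; have r2 := rankU1 M2 x X.
have [Tx|nTx] := pselect (T x).
  by have := inT Tx; lia.
have [E1x|/out] := pselect (ground M1 x); last by lia.
have /out : ~ ground M2 x by move=> E2x; apply: nTx; rewrite /T -capT.
by lia.
Qed.

Lemma xi_rankU1 x X : E x -> X `<=` E -> xi (x |` X) <= (xi X).+1.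
Proof.
move=> Ex XE; have [Y [XY YE <-]] := xi_attained XE.
apply: leq_trans (eta_rankU1 Y Ex); apply: xi_le_eta; first by sets.
by move=> y [->|/YE].
Qed.

Definition eta_maximal Y : Prop :=
  Y `<=` E /\ forall Z, Y `<=` Z -> Z `<=` E -> eta Z <= eta Y -> Z `<=` Y.

(* Among the minimisers of eta above X pick one, Y, maximising
   rk_1(Y) + rk_2(Y): every minimiser above Y then has the same ranks as Y, and
   so does the union of all of them. *)
Lemma xi_attained_maximal X : X `<=` E ->
  exists Y, [/\ X `<=` Y, eta_maximal Y & eta Y = xi X].
Proof.
move=> XE.
pose p n := `[< exists Y, [/\ X `<=` Y, Y `<=` E, eta Y = xi X &
  rank M1 Y + rank M2 Y = n] >].
have exp : exists n, p n.
  have [Y [XY YE eY]] := xi_attained XE.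
  by exists (rank M1 Y + rank M2 Y); apply/asboolP; exists Y.
have lep n : p n -> n <= rank M1 E + rank M2 E.
  by move=> /asboolP[Y [_ YE _ <-]]; rewrite leq_add //; exact: rank_mono.
case: (ex_maxnP exp lep) => n /asboolP[Y [XY YE eY rY]] maxn.
have same Z : Y `<=` Z -> Z `<=` E -> eta Z <= xi X ->
    rank M1 Z <= rank M1 Y /\ rank M2 Z <= rank M2 Y.
  move=> YZ ZE eZ; have XZ := subset_trans XY YZ.
  have /maxn : p (rank M1 Z + rank M2 Z).
    by apply/asboolP; exists Z; split=> //; apply/eqP; rewrite eqn_leq eZ xi_le_eta.
  by have := rank_mono M1 YZ; have := rank_mono M2 YZ; lia.
pose K := [set x | exists Z, [/\ Y `<=` Z, Z `<=` E, eta Z <= xi X & Z x]].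
have YK : Y `<=` K by move=> x Yx; exists Y; split=> //; rewrite eY.
have KE : K `<=` E by move=> x [Z [_ ZE _ /ZE]].
have rK : rank M1 K <= rank M1 Y /\ rank M2 K <= rank M2 Y.
  split; rewrite -(setUidr YK); apply: rank_spanned => x [Z [YZ ZE eZ Zx]].
  - have [s1 _] := same Z YZ ZE eZ.
    by apply: leq_trans s1; apply: rank_mono => y [->|/YZ].
  - have [_ s2] := same Z YZ ZE eZ.
    by apply: leq_trans s2; apply: rank_mono => y [->|/YZ].
have eK : eta K <= xi X.
  have := eta_rank K; have := eta_rank Y; have := rank_mono M YK.
  by lia.
have XK := subset_trans XY YK.
exists K; split=> //; last by apply/eqP; rewrite eqn_leq eK xi_le_eta.
split=> // Z KZ ZE eZ x Zx; exists Z; split=> //; first exact: subset_trans KZ.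
exact: leq_trans eK.
Qed.

(** If a point of [T] leaves one of the two ranks unchanged, the other grows by no more than the
    rank in [M]. So [eta] does not grow, and maximality puts the point in [Y]. *)
Lemma eta_maximal_spans Y : eta_maximal Y ->
  spans_no_new M M1 Y /\ spans_no_new M M2 Y.
Proof.
move=> [YE maxY].
have mem x : T x -> eta (x |` Y) <= eta Y -> Y x.
  move=> Tx eYx; apply: (maxY (x |` Y)) => //; last by left.
  by move=> y [->|/YE//]; exact: TE.
have eY := eta_rank Y.
split=> x Tx sx; apply: mem => //; have := eta_rank (x |` Y).
- have xT : [set x] `<=` T by move=> _ ->.
  by have := extension_rankU extM2 Y xT; lia.
- have xT : [set x] `<=` T by move=> _ ->.
  by have := extension_rankU extM1 Y xT; lia.
Qed.

(** [Z] and [W] serve to bound [xi] at the union and the intersection; at most one of them has to be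
    enlarged. *)
Lemma eta_submodular_hull X Y : OTE M -> rank M T = 4 ->
  eta_maximal X -> eta_maximal Y ->
  exists Z W, [/\ X `|` Y `<=` Z, Z `<=` E, X `&` Y `<=` W, W `<=` E &
    eta Z + eta W <= eta X + eta Y].
Proof.
move=> oteM rT.
(* By symmetry [Y] has the smaller trace, so [G] is the line when the other trace is a plane. *)
wlog leYX : X Y / rank M Y <= rank M X.
  move=> wl mX mY; have [|/ltnW leXY] := leqP (rank M Y) (rank M X).
    by move=> /wl; exact.
  have [Z [W]] := wl Y X leXY mY mX; rewrite (setUC Y) (setIC Y) (addnC (eta Y)) => ?.
  by exists Z, W.
move=> mX mY; have [[XE _] [YE _]] := (mX, mY).
have XYE : X `|` Y `<=` E by sets.
have XyE : X `&` Y `<=` E by sets.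
have [le|] := leqP (eta (X `|` Y) + eta (X `&` Y)) (eta X + eta Y).
  by exists (X `|` Y), (X `&` Y); split.
have [clX1 clX2] := eta_maximal_spans mX.
have [clY1 clY2] := eta_maximal_spans mY.
have flF := spans_no_new_flat extM1 clX1.
have flG := spans_no_new_flat extM1 clY1.
have clD1 := spans_no_newI clX1 clY1; have clD2 := spans_no_newI clX2 clY2.
rewrite -/T in flF flG.
pose F := X `&` T; pose G := Y `&` T; rewrite -/F -/G in flF flG.
have [[FT _] [GT _]] := (flF, flG).
have FX : F `<=` X by rewrite /F; sets.
have GY : G `<=` Y by rewrite /G; sets.
have rX : rank M X = rank M F by rewrite rankIground.
have rY : rank M Y = rank M G by rewrite rankIground.
have rU : rank M (X `|` Y) = rank M (F `|` G).
  by rewrite -(rankIground M (X `|` Y)) setIUl.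
have rI : rank M (X `&` Y) = rank M (F `&` G).
  by rewrite -(rankIground M (X `&` Y)) setIIl.
have eU := eta_rank (X `|` Y); have eI := eta_rank (X `&` Y).
have eX := eta_rank X; have eY := eta_rank Y.
have sm N : rank N (X `|` Y) + rank N (X `&` Y) <= rank N X + rank N Y.
  exact: rank_submod.
have s1 := sm M1; have s2 := sm M2.
rewrite rX rY rU rI in leYX eU eI eX eY => lt.
(* By [lt], the defect of [F], [G] in [M] exceeds the sum of the defects of [X], [Y] in [M1] and
   [M2]; comparable flats have defect 0. *)
have nFG : ~ F `<=` G.
  by move=> FG; move: eU eI; rewrite (setUidr FG) (setIidl FG); lia.
have nGF : ~ G `<=` F.
  by move=> GF; move: eU eI; rewrite (setUidl GF) (setIidr GF); lia.
have FGT : F `|` G `<=` T by sets.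
have iF : rank M (F `&` G) < rank M F.
  rewrite ltnNge; apply/negP => le; apply: nFG.
  have sub := flat_spanned (flatI flF flG) (@subIsetl _ _ _) FT le.
  by sets.
have iG : rank M (F `&` G) < rank M G.
  rewrite ltnNge; apply/negP => le; apply: nGF.
  have sub := flat_spanned (flatI flF flG) (@subIsetr _ _ _) GT le.
  by sets.
have uF : rank M F < rank M (F `|` G).
  rewrite ltnNge; apply/negP => le; apply: nGF.
  by have sub := flat_spanned flF (@subsetUl _ _ _) FGT le; sets.
have uG : rank M G < rank M (F `|` G).
  rewrite ltnNge; apply/negP => le; apply: nFG.
  by have sub := flat_spanned flG (@subsetUr _ _ _) FGT le; sets.
have uT := rank_mono M FGT; rewrite rT in uT.
have hyp : rank M F = 3 -> rank M G = 3 -> False.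
  move=> rF rG; have := OTE_hyperplanes oteM flF flG.
  by rewrite -/T rT rF rG /modular_pair => /(_ erefl erefl); lia.
(* The strict rank inequalities, the bound 4 and [hyp] leave only these two shapes, both of defect
   exactly 1; hence the defects in [M1] and [M2] vanish. *)
have [rG rFG mod1 mod2 shape] : [/\ rank M G = 2, rank M (F `&` G) = 0,
    rank M1 X + rank M1 Y <= rank M1 (X `|` Y) + rank M1 (X `&` Y),
    rank M2 X + rank M2 Y <= rank M2 (X `|` Y) + rank M2 (X `&` Y) &
    rank M F = 2 /\ rank M (F `|` G) = 3 \/ rank M F = 3 /\ rank M (F `|` G) = 4].
  by split; lia.
have nFD : ~ F `<=` X `&` Y by move=> FD; apply: nFG; rewrite /G; sets.
have nGD : ~ G `<=` X `&` Y by move=> GD; apply: nGF; rewrite /F; sets.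
have side N : extension N M -> spans_no_new M N (X `&` Y) ->
    rank N X + rank N Y <= rank N (X `|` Y) + rank N (X `&` Y) ->
    (rank M F = 2 -> rank M (F `|` G) = 3 ->
       rank N (T `|` (X `|` Y)) <= rank N (X `|` Y)) /\
    (rank M F = 3 -> rank M (F `|` G) = 4 ->
       rank N (F `|` X `&` Y) <= (rank N (X `&` Y)).+1).
  move=> eN clD mod.
  have ltF := spans_no_new_lt clD FT nFD; have ltG := spans_no_new_lt clD GT nGD.
  have skew := modular_pair_contract FX GY mod.
  have [A B] := nonmodular_skew eN oteM flF flG rT rG rFG ltF ltG skew.
  split=> // rF ru; have := A rF ru.
  (* What [F u G u D] spans is spanned by the larger set [X u Y]. *)
  have : rank N (T `|` (X `|` Y)) + rank N (F `|` G `|` X `&` Y) <=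
    rank N (X `|` Y) + rank N (T `|` X `&` Y) by apply: rank_submod; sets.
  by rewrite -/T; lia.
have [A1 B1] := side M1 extM1 clD1 mod1; have [A2 B2] := side M2 extM2 clD2 mod2.
case: shape => -[rF ru].
(* Adding [T] keeps the ranks in [M1] and [M2] and raises the rank in [M] from 3 to 4, so [eta]
   drops by 1. *)
- exists (T `|` (X `|` Y)), (X `&` Y); split=> //; try by sets.
  have := eta_rank (T `|` (X `|` Y)); have := A1 rF ru; have := A2 rF ru.
  have := rank_mono M (@subsetUl _ T (X `|` Y)); rewrite rT.
  by lia.
(* Adding [F] raises the ranks in [M1] and [M2] by at most 1 each and the rank in [M] from 0 to at
   least 3, so [eta] drops by at least 1. *)
- exists (X `|` Y), (F `|` X `&` Y); split=> //; try by sets.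
  have := eta_rank (F `|` X `&` Y); have := B1 rF ru; have := B2 rF ru.
  have := rank_mono M (@subsetUl _ F (X `&` Y)); rewrite rF.
  by lia.
Qed.

Lemma xi_submodular : OTE M -> rank M T = 4 -> submodular_on E xi.
Proof.
move=> oteM rT X Y XE YE.
have [X' [XX' mX <-]] := xi_attained_maximal XE.
have [Y' [YY' mY <-]] := xi_attained_maximal YE.
have [Z [W [XYZ ZE XYW WE le]]] := eta_submodular_hull oteM rT mX mY.
apply: leq_trans le; apply: leq_add; apply: xi_le_eta => //; by sets.
Qed.

(** Submodularity handles one point at a time; a maximal minimiser [Y] above [X] absorbs each point
    of [A] separately, and so contains [A] even if [A] is infinite. *)
Lemma xi_spanned X A : submodular_on E xi -> X `<=` E -> A `<=` E ->
  (forall x, A x -> xi (x |` X) <= xi X) -> xi (X `|` A) <= xi X.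
Proof.
move=> submod XE AE spA.
have [Y [XY [YE maxY] eY]] := xi_attained_maximal XE.
rewrite -eY; apply: xi_le_eta => // x [/XY//|Ax].
have xXE : x |` X `<=` E by move=> y [->|/XE//]; exact: AE.
have xYE : x |` Y `<=` E by move=> y [->|/YE//]; exact: AE.
have leY : xi Y <= xi X by rewrite -eY; exact: xi_le_eta.
have [Z [xYZ ZE eZ]] := xi_attained xYE.
apply: (maxY Z) => //; first by sets.
  rewrite eZ eY; have := submod Y (x |` X) YE xXE.
  have := spA x Ax.
  have -> : Y `|` (x |` X) = x |` Y by rewrite setUCA (setUidl XY).
  have : xi X <= xi (Y `&` (x |` X)) by apply: xi_mono; sets.
  by lia.
by apply: xYZ; left.
Qed.

(** The choice [Y = X] gives the upper bound, as [X] meets the ground set of [M2] inside [T]. Below,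
    the rank in [M2] dominates that in [M], so [eta] dominates the rank in [M1]. *)
Lemma xi_ground1 X : X `<=` ground M1 -> xi X = rank M1 X.
Proof.
move=> XE1; have XE : X `<=` E by rewrite /E; sets.
apply/eqP; rewrite eqn_leq; apply/andP; split.
  have := xi_le_eta (@subset_refl _ X) XE; have := eta_rank X.
  have : rank M2 X <= rank M X.
    rewrite -(extension_rank X extM2) -(rankIground M2 X) -capT.
    by apply: rank_mono; sets.
  by lia.
have [Y [XY YE <-]] := xi_attained XE.
have := eta_rank Y; have := extension_rank_le extM2 Y; have := rank_mono M1 XY.
by lia.
Qed.

End Amalgam.

(** * A matroid of finite rank from an abstract rank function *)

Section RankAxioms.
Context {U : Type} (E : set U) (f : set U -> nat).
Context (f0 : f set0 = 0)
  (fmono : forall X Y, X `<=` Y -> Y `<=` E -> f X <= f Y)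
  (fU1 : forall x X, E x -> X `<=` E -> f (x |` X) <= (f X).+1)
  (fspan : forall X A, X `<=` E -> A `<=` E ->
    (forall x, A x -> f (x |` X) <= f X) -> f (X `|` A) <= f X).
Implicit Types (I J X A : set U).

Let ind I : Prop := I `<=` E /\ I #= `I_(f I).

Let fU A X n : A #= `I_n -> A `<=` E -> X `<=` E -> f (A `|` X) <= f X + n.
Proof.
elim: n A => [|n IHn] A; first by rewrite II0 card_eq0 => /eqP ->; rewrite set0U addn0.
move=> /eq_cardSP[x Ax cAx] AE XE.
have AxE : A `\ x `<=` E by move=> y [/AE].
have -> : A `|` X = x |` (A `\ x `|` X) by rewrite setUA setD1K.
apply: leq_trans (fU1 _ _) _; [exact: AE|by sets|].
by rewrite addnS ltnS; exact: IHn.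
Qed.

Let indU1 I x : ind I -> E x -> f I < f (x |` I) -> ~ I x /\ ind (x |` I).
Proof.
move=> [IE cI] Ex lt.
have nIx : ~ I x.
  by move=> Ix; move: lt; rewrite setUidr ?ltnn // => _ ->.
split=> //; split; first by move=> y [->|/IE].
have -> : f (x |` I) = (f I).+1 by apply/eqP; rewrite eqn_leq fU1.
exact: card_eqU1 cI nIx.
Qed.

(** Independent sets are the finite sets on which [f] counts the elements. If no point of a set
    augments [I], then [fspan] bounds [f] on the whole set by [f I]; this gives both augmentation
    and the rank formula. *)
Lemma matroid_of_rank : exists N : matroid U,
  [/\ ground N = E, forall I, indep N I <-> I `<=` E /\ I #= `I_(f I) &
    forall X, X `<=` E -> rank N X = f X].
Proof.
have ind0 : ind set0 by split=> //; rewrite f0 II0 card_eq00.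
have indS I J : ind J -> I `<=` J -> ind I.
  move=> [JE cJ] IJ; have IE : I `<=` E by sets.
  have finJ : finite_set J by apply/finite_setP; exists (f J).
  have /finite_setP[a cI] : finite_set I by exact: sub_finite_set finJ.
  have /finite_setP[b cD] : finite_set (J `\` I) by exact: finite_setD.
  have eJ : J = J `\` I `|` I by rewrite setUC setDUK.
  split=> //; suff -> : f I = a by [].
  have DE : J `\` I `<=` E by move=> y [/JE].
  (* Unit increments give [f J <= f I + b] and [f I <= a]; since [f J = a + b], equality holds
     throughout. *)
  have := fU cD DE IE; have := fU cI IE (@sub0set _ E); rewrite setU0 f0 -eJ.
  have c0 : (J `\` I) `&` I #= `I_0 by rewrite setDKI II0 card_eq00.
  have := card_eqUI cD cI _ c0; rewrite -eJ => /(_ _ cJ).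
  by lia.
have ind_aug I J : ind I -> ind J -> ~~ (J #<= I) ->
    exists x, [/\ J x, ~ I x & ind (x |` I)].
  move=> iI iJ; have [[IE cI] [JE cJ]] := (iI, iJ).
  rewrite (card_le_nat cJ cI) -ltnNge => lt; apply: contrapT => noaug.
  have : f (I `|` J) <= f I.
    apply: fspan => // x Jx; rewrite leqNgt; apply/negP => ltx.
    have [nIx ix] := indU1 iI (JE x Jx) ltx.
    by apply: noaug; exists x.
  have : f J <= f (I `|` J) by apply: fmono; sets.
  by lia.
have ind_bd : exists r : nat, forall I, ind I -> I #<= `I_r.
  exists (f E) => I [IE cI]; rewrite (card_le_eql cI) card_le_II.
  exact: fmono.
pose N := @Matroid U E ind (fun I iI => proj1 iI) ind0 indS ind_aug ind_bd.
have rind J : ind J -> rank N J = f J.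
  by move=> iJ; exact: card_eq_uniq (rank_indep (M := N) iJ) (proj2 iJ).
exists N; split=> // X XE; have [I [iI IX rI]] := rank_basis N X.
rewrite -rI rind //; apply/eqP; rewrite eqn_leq fmono //= -(setUidr IX).
apply: fspan => // [|x Xx]; first exact: (proj1 iI).
rewrite leqNgt; apply/negP => ltx.
have [nIx ix] := indU1 iI (XE x Xx) ltx.
have : rank N (x |` I) <= rank N X by apply: rank_mono => y [->|/IX].
by rewrite -rI !rind // leqNgt ltx.
Qed.

End RankAxioms.

(** * Symmetry in the two extensions and existence of the proper amalgam *)

Lemma xiC (U : Type) (M M1 M2 : matroid U) : xi M M2 M1 = xi M M1 M2.
Proof.
have -> : xi M M2 M1 = fun X => xget 0 (xi_spec M M2 M1 X) by [].
apply/funext => X; rewrite /xi /xi_spec setUC.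
by have -> : eta M M2 M1 = eta M M1 M2 by apply/funext => Y; rewrite /eta addnC.
Qed.

Theorem theorem16 (U : Type) (M M1 M2 : matroid U)
    (rankM : rank M (ground M) = 4)
    (oteM : OTE M)
    (extM1 : extension M1 M)
    (extM2 : extension M2 M)
    (capT : ground M1 `&` ground M2 = ground M)
    (count1 : countable (ground M1))
    (count2 : countable (ground M2)) :
  submodular_on (ground M1 `|` ground M2) (xi M M1 M2) /\
  exists N : matroid U, proper_amalgam N M M1 M2.
Proof.
have submod := xi_submodular extM1 extM2 oteM rankM; split=> //.
have xi1 := xi_ground1 extM1 extM2 capT.
have xi2 X : X `<=` ground M2 -> xi M M1 M2 X = rank M2 X.
  by rewrite -xiC; apply: xi_ground1 => //; rewrite setIC.
have xi0 : xi M M1 M2 set0 = 0 by rewrite xi1 // rank0.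
have [N [gN iN rN]] := matroid_of_rank xi0 (@xi_mono _ M M1 M2)
  (xi_rankU1 extM1 capT)
  (fun X A XE AE => xi_spanned extM1 submod XE AE).
(* Independence on both sides means that the cardinality equals the rank, and the two ranks agree on
   the ground set of [Mi]. *)
have ext Mi : ground Mi `<=` ground N ->
    (forall X, X `<=` ground Mi -> xi M M1 M2 X = rank Mi X) -> extension N Mi.
  move=> sub xii; split=> // I IE; rewrite iN indepE xii // -gN.
  by split=> -[? ?]; split=> //; exact: subset_trans sub.
exists N; split; last by move=> X; rewrite gN; exact: rN.
by split=> //; apply: ext => //; rewrite gN.
Qed.
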